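(* For every integer $m\ge 3$, $$\hat{r}(2K_2,3P_m)=\min\{3m+1,\,4m-4\}=\begin{cases} 4m-4, & m=3,4,\\ 3m+1, & m\ge 5.\end{cases}$$
   Context: All graphs are finite and simple. The size $e(F)$ of a graph $F$ is its number of edges. For graphs $F,G,H$, write $F\to(G,H)$ if for every coloring of the edges of $F$ with the colors red and blue, $F$ contains either a subgraph isomorphic to $G$ all of whose edges are red, or a subgraph isomorphic to $H$ all of whose edges are blue (subgraphs are not necessarily induced). The size Ramsey number $\hat{r}(G,H)$ is the smallest possible size of a graph $F$ with $F\to(G,H)$. $P_m$ denotes the path on $m$ vertices (with $m-1$ edges), $nP_m$ is the disjoint union of $n$ copies of $P_m$, and $2K_2$ is the disjoint union of two edges (a matching of size 2). *)

(* Defs.v *)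
From mathcomp Require Import all_boot.
Set Implicit Arguments.
Unset Strict Implicit.
Unset Printing Implicit Defensive.

Record sgraph := SGraph {
  vertex :> finType;
  adj : rel vertex;
  adj_sym : symmetric adj;
  adj_irrefl : irreflexive adj }.

Definition edges (F : sgraph) : {set {set F}} :=
  [set [set u.1; u.2] | u : F * F & adj u.1 u.2].

Definition gsize (F : sgraph) : nat := #|edges F|.

(* F has a (not necessarily induced) subgraph isomorphic to G: the image of f,
   with the images of the edges of G as edges, is such a subgraph. *)
Definition contains_copy (F G : sgraph) : Prop :=
  exists2 f : G -> F, injective f & forall x y, adj x y -> adj (f x) (f y).

Definition color := bool.
Definition red : color := true.
Definition blue : color := false.

(* Edge colorings are functions on all vertex sets; the values outside
   [edges F] are never used. *)
Definition coloring (F : sgraph) := {set F} -> color.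

Section MonochromaticSubgraph.
Variables (F : sgraph) (c : coloring F) (k : color).

Definition mono_adj : rel F :=
  fun x y => adj x y && (c [set x; y] == k).

Lemma mono_adj_sym : symmetric mono_adj.
Proof. by move=> x y; rewrite /mono_adj adj_sym setUC. Qed.

Lemma mono_adj_irrefl : irreflexive mono_adj.
Proof. by move=> x; rewrite /mono_adj adj_irrefl. Qed.

Definition mono_subgraph : sgraph := SGraph mono_adj_sym mono_adj_irrefl.

End MonochromaticSubgraph.

Definition arrows (F G H : sgraph) : Prop :=
  forall c : coloring F,
    contains_copy (mono_subgraph c red) G \/
    contains_copy (mono_subgraph c blue) H.

(* r is the size Ramsey number of (G, H). A relation, so that asserting it
   includes the existence of some F with F -> (G, H). *)
Definition is_size_ramsey (G H : sgraph) (r : nat) : Prop :=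
  (exists2 F : sgraph, arrows F G H & gsize F = r) /\
  (forall F : sgraph, arrows F G H -> r <= gsize F).

Section Path.
Variable m : nat.

Definition path_adj : rel 'I_m :=
  fun i j => (i.+1 == j :> nat) || (j.+1 == i :> nat).

Lemma path_adj_sym : symmetric path_adj.
Proof. by move=> i j; rewrite /path_adj orbC. Qed.

Lemma path_adj_irrefl : irreflexive path_adj.
Proof. by move=> i; rewrite /path_adj orbb gtn_eqF. Qed.

(* m counts vertices, not edges. *)
Definition path_graph : sgraph := SGraph path_adj_sym path_adj_irrefl.

End Path.

Section Complete.
Variable n : nat.

Definition complete_adj : rel 'I_n := fun i j => i != j.

Lemma complete_adj_sym : symmetric complete_adj.
Proof. by move=> i j; rewrite /complete_adj eq_sym. Qed.

Lemma complete_adj_irrefl : irreflexive complete_adj.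
Proof. by move=> i; rewrite /complete_adj eqxx. Qed.

Definition complete_graph : sgraph :=
  SGraph complete_adj_sym complete_adj_irrefl.

End Complete.

Section Copies.
Variables (n : nat) (G : sgraph).

Definition copies_adj : rel ('I_n * G) :=
  fun u v => (u.1 == v.1) && adj u.2 v.2.

Lemma copies_adj_sym : symmetric copies_adj.
Proof. by move=> u v; rewrite /copies_adj eq_sym adj_sym. Qed.

Lemma copies_adj_irrefl : irreflexive copies_adj.
Proof. by move=> u; rewrite /copies_adj adj_irrefl andbF. Qed.

(* The disjoint union of n copies of G. *)
Definition copies : sgraph := SGraph copies_adj_sym copies_adj_irrefl.

End Copies.

(* Main.v *)
(* Upper bound: both [4P_m] and the cycle on [3m+1] vertices are triangle-free
   and still contain [3P_m] after deletion of any vertex; in a triangle-free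
   graph pairwise intersecting edges share a vertex, so this suffices.

   Lower bound: if [F -> (2K_2, kG)] with [G] connected, then [F - v] contains
   [kG] for every [v]. Let [U] be the union of the components of [F] that
   contain [G]; it has more than [k|G|] vertices. Either [F[U]] has at least
   [|U|] edges, or one of these components is a tree. In a rooted tree
   containing [G], a minimal rooted subtree containing [G], with root [v] say,
   is such that every copy of [G] meeting it passes through [v]; so the [k]
   copies in [F - v] together with one in that subtree form [(k+1)G]. *)
Require Import Defs.
From mathcomp Require Import all_boot zify.

Set Implicit Arguments.
Unset Strict Implicit.
Unset Printing Implicit Defensive.

(** * Embeddings, and colorings without two disjoint red edges *)

Definition embedding (G F : sgraph) (f : G -> F) : Prop :=
  injective f /\ forall x y, adj x y -> adj (f x) (f y).

Definition connected (G : sgraph) : Prop := forall x y : G, connect (@adj G) x y.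

Definition triangle_free (F : sgraph) : Prop :=
  forall x y z : F, adj x y -> adj y z -> adj z x -> False.

Lemma connected_ind (G : sgraph) (P : pred G) (a : G) :
    connected G -> P a -> (forall x y, P x -> adj x y -> P y) ->
  forall x, P x.
Proof.
move=> conG Pa step x; have /connectP[p] := conG a x.
elim: p a Pa => [|b p IHp] a Pa /= => [_ -> //|/andP[ab pth] xE].
exact: IHp (step _ _ Pa ab) pth xE.
Qed.

Lemma contains_matching (F : sgraph) (x y z t : F) :
    adj x y -> adj z t -> x \notin [set z; t] -> y \notin [set z; t] ->
  contains_copy F (copies 2 (complete_graph 2)).
Proof.
move=> xy zt; rewrite !inE !negb_or => /andP[xz xt] /andP[yz yt].
have nxy : x != y by apply: contraTneq xy => ->; rewrite adj_irrefl.
have nzt : z != t by apply: contraTneq zt => ->; rewrite adj_irrefl.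
pose f (u : copies 2 (complete_graph 2)) : F :=
  if u.1 == ord0 then if u.2 == ord0 then x else y
  else if u.2 == ord0 then z else t.
have I2 (i : 'I_2) : i = ord0 \/ i = ord_max.
  by case: i => [[|[|i]] //] lti; [left|right]; apply: val_inj.
exists f.
  move=> [i j] [k l]; rewrite /f /=.
  by case: (I2 i) => ->; case: (I2 j) => ->; case: (I2 k) => ->;
    case: (I2 l) => -> //= e; exfalso; move: nxy nzt xz xt yz yt;
    rewrite e ?eqxx ?andbF.
move=> [i j] [k l]; rewrite /= /copies_adj /f /= => /andP[/eqP <-].
rewrite /complete_adj.
by case: (I2 i) => ->; case: (I2 j) => ->; case: (I2 l) => -> //= _;
  rewrite 1?adj_sym.
Qed.

Lemma mono_adjE (F : sgraph) (c : coloring F) (k : color)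
    (x y : mono_subgraph c k) :
  adj x y = (@adj F x y) && (c [set (x : F); (y : F)] == k).
Proof. by []. Qed.

(** If the end [x] of a red edge [x y] is not common to all red edges, there is a red edge [y d]
    with [d] distinct from [x]. A red edge avoiding [y] meets both, so it joins [x] to [d] and
    closes a triangle. Any vertex serves when no edge is red. *)
Lemma red_edges_share_vertex (F : sgraph) (c : coloring F) :
    F -> triangle_free F ->
  contains_copy (mono_subgraph c red) (copies 2 (complete_graph 2)) \/
  exists v : F, forall x y : F, mono_adj c red x y -> v \in [set x; y].
Proof.
move=> x0 tri.
case: (pickP (fun w : (F * F) * (F * F) =>
   [&& mono_adj c red w.1.1 w.1.2, mono_adj c red w.2.1 w.2.2,
       w.1.1 \notin [set w.2.1; w.2.2] & w.1.2 \notin [set w.2.1; w.2.2]])) =>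
    [[[x y] [z t]] /= /and4P[xy zt nx ny]|nodisj].
  by left; apply: (@contains_matching (mono_subgraph c red) x y z t).
right; have meet (x y z t : F) : mono_adj c red x y -> mono_adj c red z t ->
    (x \in [set z; t]) || (y \in [set z; t]).
  move=> xy zt; apply/negPn; rewrite negb_or.
  by have:= nodisj ((x, y), (z, t)); rewrite /= xy zt /= => ->.
case: (pickP (fun u : F * F => mono_adj c red u.1 u.2)) => [[x y] /= xy|none];
  last by exists x0 => x y xy; have:= none (x, y); rewrite /= xy.
case: (pickP (fun u : F * F =>
         mono_adj c red u.1 u.2 && (x \notin [set u.1; u.2]))) =>
    [[a b] /=|allx]; last first.
  exists x => a b ab; apply/negPn/negP => xab.
  by have := allx (a, b); rewrite /= ab xab.
move=> /andP[ab xab]; have := meet _ _ _ _ xy ab; rewrite (negPf xab) /= => yab.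
have [d yd nxd] : exists2 d, mono_adj c red y d & x != d.
  move: yab xab; rewrite !inE => /orP[/eqP ->|/eqP ->]; rewrite negb_or.
    by case/andP=> _ ?; exists b.
  by case/andP=> ? _; exists a => //; rewrite mono_adj_sym.
exists y => p q pq; apply/negPn/negP => ypq.
have:= meet _ _ _ _ xy pq; have:= meet _ _ _ _ yd pq.
rewrite (negPf ypq) orbF /= => dpq xpq.
have xd : adj x d.
  case/andP: pq => pq _; move: dpq xpq; rewrite !inE.
  by case/orP=> /eqP dE; case/orP=> /eqP xE; move: nxd; rewrite dE xE ?eqxx //;
    rewrite adj_sym.
case/andP: xy => xy _; case/andP: yd => yd _.
by apply: (tri x y d) => //; rewrite adj_sym.
Qed.

(** A copy of [H] that avoids a vertex common to all red edges is entirely blue. *)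
Lemma arrows_2K2 (F H : sgraph) :
    F -> triangle_free F ->
    (forall v : F, exists2 f : H -> F, embedding f & forall x, f x != v) ->
  arrows F (copies 2 (complete_graph 2)) H.
Proof.
move=> x0 tri del c.
have [|[v share]] := red_edges_share_vertex c x0 tri; [by left | right].
have [f [finj fadj] fv] := del v; exists f => // x y xy.
rewrite mono_adjE (fadj _ _ xy) /=; apply: contraT => nblue.
have /share : mono_adj c red (f x) (f y).
  by rewrite /mono_adj (fadj _ _ xy) /=; move: nblue; case: (c _).
by rewrite !inE eq_sym (negPf (fv x)) eq_sym (negPf (fv y)).
Qed.

(** Color red exactly the edges at [v]. They form a star, so no red matching of size 2 exists, and
    each vertex of a blue copy of [H] lies on a blue edge, hence differs from [v]. *)
Lemma arrows_2K2_delete (F H : sgraph) (v : F) :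
    (forall x : H, exists y, adj x y) ->
    arrows F (copies 2 (complete_graph 2)) H ->
  exists2 f : H -> F, embedding f & forall x, f x != v.
Proof.
move=> noiso /(_ (fun E => v \in E))[[f finj fadj]|[f finj fadj]].
  have hit (i : 'I_2) : exists j : 'I_2, v = f (i, j).
    have: adj (f (i, ord0)) (f (i, ord_max)) by apply: fadj; rewrite /= /copies_adj eqxx.
    rewrite mono_adjE => /andP[_ /eqP].
    by rewrite !inE => /orP[/eqP|/eqP]; [exists ord0|exists ord_max].
  by have [j vj] := hit ord0; have [k] := hit ord_max; rewrite vj => /finj.
exists f => [|x].
  by split=> // x y /fadj; rewrite mono_adjE => /andP[].
have [y /fadj] := noiso x; rewrite mono_adjE => /andP[_].
by rewrite !inE /blue; case: (v =P f x) => // /eqP; rewrite eq_sym.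
Qed.

(** * Degree sums of induced subgraphs *)

Section EdgeCounting.
Variable F : sgraph.
Implicit Types (U : {set F}) (x y : F).

(* Twice the number of edges inside [U]. *)
Definition arcs U := \sum_(x in U) #|[set y in U | adj x y]|.

Lemma arcs_le U : arcs U <= (gsize F).*2.
Proof.
pose A := [set u : F * F | adj u.1 u.2].
have -> : (gsize F).*2 = #|setX (edges F) [set: bool]|.
  by rewrite cardsX cardsT card_bool muln2.
(* The Boolean records the orientation, so the two arcs of an edge have distinct images. *)
pose g (u : F * F) := ([set u.1; u.2], enum_rank u.1 < enum_rank u.2).
apply: (@leq_trans #|A|).
  rewrite /arcs -sum1_card.
  rewrite (eq_bigl (fun u : F * F => (u.1 \in [set: F]) && adj u.1 u.2));
    last by move=> u; rewrite !inE.
  rewrite -(pair_big_dep (fun x => x \in [set: F]) (fun x y => adj x y)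
              (fun _ _ => 1)) /=.
  rewrite [leqRHS](bigID (mem U)) /=; apply: leq_trans (leq_addr _ _).
  rewrite [leqRHS](eq_bigl (mem U)); last by move=> x; rewrite inE.
  apply: leq_sum => x _; rewrite sum1_card; apply: subset_leq_card.
  by apply/subsetP=> y; rewrite !inE => /andP[].
have ginj : {in A &, injective g}.
  move=> [x y] [z t]; rewrite !inE /= => xy zt [E r].
  have nxy : x != y by apply: contraTneq xy => ->; rewrite adj_irrefl.
  have xE : x \in [set z; t] by rewrite -E set21.
  have yE : y \in [set z; t] by rewrite -E set22.
  move: xE yE r nxy; rewrite !inE.
  case/orP=> /eqP ->; case/orP=> /eqP -> //; rewrite ?eqxx // => r nzt.
  have: enum_rank z != enum_rank t :> nat.
    by rewrite val_eqE (inj_eq enum_rank_inj) eq_sym.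
  by move: r; case: ltngtP.
rewrite -(card_in_imset ginj); apply: subset_leq_card.
apply/subsetP=> _ /imsetP[u uA ->]; rewrite inE inE andbT.
by apply/imsetP; exists u => //; rewrite inE in uA.
Qed.

Lemma low_degree U :
  arcs U < #|U|.*2 -> exists2 v, v \in U & #|[set y in U | adj v y]| <= 1.
Proof.
case: (pickP (fun v => (v \in U) && (#|[set y in U | adj v y]| <= 1))).
  by move=> v /andP[vU degv] _; exists v.
move=> deg2; rewrite ltnNge -muln2 -sum_nat_const => /negP[].
by apply: leq_sum => x xU; have:= deg2 x; rewrite xU ltnNge /= => ->.
Qed.

(** The degree of [v] is lost twice: as its own term, and as one unit at each neighbor. *)
Lemma arcs_D1 U v :
  v \in U -> arcs (U :\ v) + #|[set y in U | adj v y]|.*2 = arcs U.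
Proof.
move=> vU; rewrite {2}/arcs (big_setD1 v) //= -addnn addnCA; congr addn.
rewrite -sum1_card.
rewrite (eq_bigl (fun y => (y \in U :\ v) && adj v y)); last first.
  by move=> y; rewrite !inE; case: eqP => // ->; rewrite adj_irrefl andbF.
rewrite big_mkcondr -big_split /=; apply: eq_bigr => x.
rewrite !inE => /andP[xv xU].
rewrite [RHS](cardsD1 v) !inE vU adj_sym /= [RHS]addnC; congr addn.
  by apply: eq_card => y; rewrite !inE; case: eqP.
Qed.

End EdgeCounting.

(** * Rooted forests in sparse graphs *)

Section Forests.
Variable F : sgraph.
Implicit Types (C U : {set F}) (x y z v : F).

(** For [C] inside [U], this makes [C] a union of components of the subgraph induced on [U]. *)
Definition closed_in U C := forall x y, x \in C -> y \in U -> adj x y -> y \in C.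

(* A rooted forest on [C]: each vertex has at most one neighbour of larger
   height, namely its parent. *)
Definition forest_order C (h : F -> nat) :=
  {in C &, injective h} /\
  forall x y z, x \in C -> y \in C -> z \in C -> adj x y -> adj x z ->
    h x < h y -> h x < h z -> y = z.

(** Induction, deleting a vertex [v] of degree at most 1. If isolated, [v] alone is the forest.
    Otherwise exactly two arcs disappear, so the bound persists, and [v] either becomes a leaf of
    the forest found in the rest or is not adjacent to it. *)
Lemma sparse_closed_forest U :
    arcs U < #|U|.*2 ->
  exists C h, [/\ C \subset U, C != set0, closed_in U C & forest_order C h].
Proof.
have [n] := ubnP #|U|; elim: n U => // n IHn U ltUn small.
have [v vU degv] := low_degree small.
have := arcs_D1 vU; have cardU := cardsD1 v U; rewrite vU /= add1n in cardU.
case: (posnP #|[set y in U | adj v y]|) degv => [deg0 _ _|deg_gt0 deg_le1 arcsE].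
  exists [set v], (fun=> 0); split.
  - by rewrite sub1set.
  - by apply/set0Pn; exists v; rewrite set11.
  - move=> x y /set1P -> yU vy.
    by have := cards0_eq deg0 => /setP/(_ y); rewrite !inE yU vy.
  - by split=> [x y /set1P -> /set1P -> //|x y z /set1P -> /set1P -> /set1P ->].
have [||C [h [CU Cn0 Ccl [hinj hpar]]]] := IHn (U :\ v).
- by rewrite cardU in ltUn.
- by move: small arcsE deg_gt0; rewrite cardU; lia.
have [w wU] : exists w, [set y in U | adj v y] = [set w].
  by apply/cards1P; rewrite eqn_leq deg_le1.
have vwP y : y \in U -> adj v y -> y = w.
  by move=> yU vy; apply/set1P; rewrite -wU inE yU.
have vC : v \notin C by apply: contraTN CU => vC; apply/subsetPn; exists v; rewrite ?setD11.
have CUs : C \subset U by apply: subset_trans CU (subsetDl _ _).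
have [wC|wnC] := boolP (w \in C); last first.
  exists C, h; split=> // x y xC yU xy; apply: (Ccl x y xC _ xy); rewrite !inE yU andbT.
  apply: contraNneq wnC => yv.
  by have <- : x = w by apply: vwP; [exact: (subsetP CUs) | rewrite adj_sym -yv].
(* Shifting the old heights up frees height 0 for the leaf [v], whose parent is [w]. *)
exists (v |: C), (fun x => if x == v then 0 else (h x).+1); split.
- by rewrite subUset sub1set vU.
- by apply/set0Pn; exists v; rewrite setU11.
- move=> x y /setU1P[->|xC] yU xy; first by rewrite (vwP y) // setU1r.
  have [->|yv] := eqVneq y v; first exact: setU11.
  by apply/setU1r/(Ccl x) => //; rewrite !inE yv.
have neqv x : x \in C -> x == v = false by move=> xC; apply: contraNF vC => /eqP <-.
split=> [x y|x y z].
  move=> /setU1P[->|xC] /setU1P[->|yC]; rewrite ?eqxx ?neqv // => -[].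
  exact: hinj.
move=> /setU1P[->|xC] /setU1P[->|yC] /setU1P[->|zC]; rewrite ?eqxx ?neqv ?adj_irrefl //.
  by move=> vy vz _ _; rewrite (vwP y (subsetP CUs y yC) vy) (vwP z (subsetP CUs z zC) vz).
exact: hpar.
Qed.

End Forests.

(** * Copies of a connected graph in a rooted forest *)

Definition embeds_in (G F : sgraph) (S : {set F}) : bool :=
  [exists f : {ffun G -> F},
    [&& injectiveb f, [forall x, [forall y, adj x y ==> adj (f x) (f y)]]
      & [forall x, f x \in S]]].

Lemma embeds_inP (G F : sgraph) (S : {set F}) :
  reflect (exists2 f : G -> F, embedding f & forall x, f x \in S)
          (embeds_in G S).
Proof.
apply: (iffP existsP) => [[f /and3P[/injectiveP finj fadj fS]]|[f [finj fadj] fS]].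
  exists f; last exact/forallP.
  by split=> // x y; move: fadj => /forallP/(_ x)/forallP/(_ y)/implyP.
exists (finfun f); apply/and3P; split.
- by apply/injectiveP => x y; rewrite !ffunE => /finj.
- by apply/forallP => x; apply/forallP => y; apply/implyP; rewrite !ffunE => /fadj.
- by apply/forallP => x; rewrite ffunE.
Qed.

Lemma connected_embedding_subset (G F : sgraph) (D : {set F}) (f : G -> F) (a : G) :
    connected G -> embedding f -> f a \in D ->
    (forall x y, f x \in D -> adj (f x) (f y) -> f y \in D) ->
  forall x, f x \in D.
Proof.
move=> conG [_ fadj] fa step; apply: (connected_ind (a := a)) => // x y xD xy.
exact/(step x)/fadj.
Qed.

(* In the proof, [D] is a minimal rooted subtree containing [G], with root [v]. *)
Lemma forest_private_copy (G F : sgraph) (C : {set F}) (h : F -> nat) :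
    G -> connected G -> forest_order C h -> closed_in [set: F] C ->
    embeds_in G C ->
  exists v (D : {set F}), embeds_in G D /\
    forall (f : G -> F) a, embedding f -> f a \in D -> exists b, f b = v.
Proof.
move=> g0 conG [hinj hpar] Ccl GC.
(* For the least [n] such that [low n] contains [G], every copy in [low n] uses the vertex of height
   [n.-1]; this is the root [v]. *)
pose low n := [set x in C | h x < n].
have ex_low : exists n, embeds_in G (low n).
  have /embeds_inP[f femb fC] := GC; exists (\max_x h (f x)).+1.
  by apply/embeds_inP; exists f => // x; rewrite inE fC ltnS leq_bigmax.
have := ex_minnP ex_low => -[n /embeds_inP[f0 f0emb f0low] nmin].
(* The image of [g0] has height below [n], so [n] is positive and [n.-1] is really smaller. *)
have {}nmin : ~~ embeds_in G (low n.-1).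
  apply/negP => /nmin; have := f0low g0; rewrite inE => /andP[_]; lia.
have [a /negP f0a] : exists a, f0 a \notin low n.-1.
  by apply/existsP; rewrite -negb_forall; apply: contraNN nmin => /forallP ?;
    apply/embeds_inP; exists f0.
have [vC hv] : f0 a \in C /\ h (f0 a) = n.-1.
  have := f0low a; move: f0a; rewrite !inE; case: (_ \in C) => //=; lia.
set v := f0 a in vC hv.
(* [child x y] makes [y] the parent of [x], so [D] consists of [v] and its descendants. *)
pose child := [rel x y | [&& x \in C, y \in C, adj x y & h x < h y]].
pose D := [set x | connect child x v].
have vD : v \in D by rewrite inE.
have lowD x : x \in D -> x != v ->
    [/\ x \in C, h x < h v & exists2 y, child x y & y \in D].
  rewrite inE => /connectP[p]; elim: p x => [|y p IHp] x /=; first by move=> _ <-; rewrite eqxx.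
  case/andP=> xy pth vE xv; have [xC yC _ hxy] := and4P xy.
  have yD : y \in D by rewrite inE; apply/connectP; exists p.
  split=> //; last by exists y.
  have [<- //|yv] := eqVneq y v.
  by have [] := IHp y pth vE yv => _ /(ltn_trans hxy).
have neq_h x y : x \in C -> y \in C -> adj x y -> h x != h y.
  move=> xC yC; apply: contraTneq => /hinj -> //; by rewrite adj_irrefl.
have downD x y : x \in D -> x \in C -> adj x y -> h y < h x -> y \in D.
  move=> xD xC xy hyx; have yC := Ccl _ _ xC (in_setT y) xy.
  rewrite inE; apply: (connect_trans (connect1 _) (y := x)); last by rewrite inE in xD.
  by rewrite /= yC xC adj_sym xy.
(* From a vertex of [D] other than [v], a lower neighbor is a child and a higher one is the unique
   parent; both are in [D]. *)
have nbrD x y : x \in D -> x != v -> adj x y -> y \in D.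
  move=> xD xv xy; have [xC hxv [p /and4P[_ pC xp hxp] pD]] := lowD x xD xv.
  have yC := Ccl _ _ xC (in_setT y) xy.
  have := neq_h x y xC yC xy; rewrite neq_ltn => /orP[hxy|]; last exact: downD.
  by rewrite (hpar x y p).
exists v, D; split.
  apply/embeds_inP; exists f0 => //.
  apply: (connected_embedding_subset conG f0emb vD) => x y xD xy.
  have [xv|xv] := eqVneq (f0 x) v; last exact: nbrD xD xv xy.
  (* All heights in this copy are at most that of [v], so the neighbors of [v] in it are
     children. *)
  apply: (downD _ _ xD _ xy _); rewrite xv // hv.
  have := f0low y; rewrite inE => /andP[yC hy].
  have := neq_h v (f0 y) vC yC; rewrite -xv => /(_ xy); rewrite xv hv; lia.
move=> f b femb fb.
case: (pickP (fun x => f x == v)) => [x /eqP <-|/(_ _)/negbT fv]; first by exists x.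
(* A copy meeting [D] but missing [v] stays among the descendants of [v], all of height below
   [n.-1]. *)
case/negP: nmin; apply/embeds_inP; exists f => // x.
have xD : f x \in D.
  by apply: (connected_embedding_subset conG femb fb) => y z yD; apply: nbrD.
by have [xC hx _] := lowD _ xD (fv x); rewrite inE xC -hv.
Qed.

(** * From [n] copies to [n.+1] copies *)

Lemma card_copies n (G : sgraph) : #|copies n G| = n * #|G|.
Proof. by rewrite card_prod card_ord. Qed.

Lemma embedding_component n (G F : sgraph) (g : copies n G -> F) (i : 'I_n) :
  embedding g -> embedding (fun x : G => g (i, x)).
Proof.
move=> [ginj gadj]; split=> [x y /ginj [] //|x y xy].
by apply: gadj; rewrite /= /copies_adj eqxx.
Qed.

Lemma connect_embedding (G F : sgraph) (f : G -> F) (x y : G) :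
  connected G -> embedding f -> connect (@adj F) (f x) (f y).
Proof.
move=> conG [_ fadj].
apply: (connected_ind (P := fun y => connect (@adj F) (f x) (f y)) (a := x)) => //.
by move=> z t fz /fadj/connect1; apply: connect_trans.
Qed.

(** With [G] a path, each alternative bounds the size of [F] below by one term of the minimum. *)
Lemma delete_vertex_copies (F G : sgraph) (n : nat) :
    F -> G -> connected G -> 0 < n ->
    (forall v : F, exists2 g : copies n G -> F, embedding g & forall u, g u != v) ->
  contains_copy F (copies n.+1 G) \/ n * #|G| + 1 <= gsize F.
Proof.
move=> x0 g0 conG n_gt0 del.
pose U := [set x : F | embeds_in G [set y | connect (@adj F) x y]].
have copyU (f : G -> F) a : embedding f -> f a \in U.
  move=> femb; rewrite inE; apply/embeds_inP; exists f => // x.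
  by rewrite inE connect_embedding.
(* Delete a vertex [f g0] of some copy: it lies in [U], and so do the [n] copies that avoid it. *)
have cardU : n * #|G| < #|U|.
  have /embeds_inP[f femb _] : embeds_in G [set: F].
    have [g gemb _] := del x0; apply/embeds_inP.
    by exists (fun x => g (Ordinal n_gt0, x)) => //; apply: embedding_component.
  have [g gemb gv] := del (f g0).
  rewrite -card_copies -cardsT -(card_imset _ (proj1 gemb)).
  apply: (@leq_trans #|f g0 |: g @: setT|).
    rewrite cardsU1; case: imsetP => [[u _ fu]|//].
    by have := gv u; rewrite fu eqxx.
  apply/subset_leq_card/subsetP => y /setU1P[->|/imsetP[[i x] _ ->]].
    exact: copyU.
  exact: (copyU (fun x => g (i, x))) (embedding_component i gemb).
have [small|] := ltnP (arcs U) #|U|.*2; last first.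
  by move=> big; right; have := arcs_le U; lia.
left; have [C [h [CU /set0Pn[x xC] Ccl Cord]]] := sparse_closed_forest small.
(* [U] is closed under adjacency in all of [F], so [C], closed in [U], is a union of components of
   [F]. *)
have adjU y z : y \in U -> adj y z -> z \in U.
  rewrite !inE => /embeds_inP[f femb fy] yz; apply/embeds_inP; exists f => // t.
  have := fy t; rewrite !inE; apply: connect_trans.
  by apply: connect1; rewrite adj_sym.
have {}Ccl : closed_in [set: F] C.
  by move=> y z yC _ yz; apply: (Ccl y z yC _ yz); apply: adjU (subsetP CU _ yC) yz.
have GC : embeds_in G C.
  have := subsetP CU x xC; rewrite inE => /embeds_inP[f femb fx].
  apply/embeds_inP; exists f => // a; have := fx a; rewrite inE.
  case/connectP=> p pth ->; elim: p x xC pth {fx} => //= y p IHp x xC /andP[xy].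
  by apply: IHp; apply: Ccl xy => //; rewrite inE.
have [v [D [/embeds_inP[f1 [f1inj f1adj] f1D] hit]]] :=
  forest_private_copy g0 conG Cord Ccl GC.
have [g gemb gv] := del v.
have gD i a : g (i, a) \notin D.
  apply/negP => /(hit (fun x => g (i, x)) a (embedding_component i gemb))[b gb].
  by have := gv (i, b); rewrite gb eqxx.
have [ginj gadj] := gemb.
(* The index [ord_max] receives the copy inside [D]; the other copies avoid [v] and therefore miss
   [D]. *)
pose f (u : copies n.+1 G) : F :=
  if unlift ord_max u.1 is Some i then g (i, u.2) else f1 u.2.
exists f.
  move=> [i x1] [j y1]; rewrite /f /=.
  case: unliftP => [i' ->|->]; case: unliftP => [j' ->|->].
  - by move/ginj => [-> ->].
  - by move=> e; have := gD i' x1; rewrite e f1D.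
  - by move=> e; have := gD j' y1; rewrite -e f1D.
  - by move/f1inj => ->.
move=> [i x1] [j y1]; rewrite /= /copies_adj /f /= => /andP[/eqP <-] xy.
case: unliftP => [i' _|_]; last exact: f1adj.
by apply: gadj; rewrite /= /copies_adj eqxx.
Qed.

(** * Disjoint unions of paths *)

Lemma gsize_embedding (F G : sgraph) : contains_copy F G -> gsize G <= gsize F.
Proof.
case=> f finj fadj; rewrite /gsize -(card_imset _ (imset_inj finj)).
apply/subset_leq_card/subsetP => _ /imsetP[_ /imsetP[u uadj ->] ->]; rewrite inE in uadj.
apply/imsetP; exists (f u.1, f u.2); first by rewrite inE fadj.
by rewrite imsetU1 imset_set1.
Qed.

Lemma gsize_copies_path n k : gsize (copies n (path_graph k.+1)) = n * k.
Proof.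
(* An edge is indexed by its copy and its lower end. *)
pose e (u : 'I_n * 'I_k) : {set copies n (path_graph k.+1)} :=
  [set (u.1, widen_ord (leqnSn k) u.2); (u.1, lift ord0 u.2)].
have einj : injective e.
  move=> [i x] [j y] /setP E; have := E (i, widen_ord (leqnSn k) x).
  have := E (i, lift ord0 x); rewrite /e /= !inE !xpair_eqE !eqxx /= orbT.
  case: (i =P j) => //= ->; rewrite -!val_eqE /= /bump /= => xy yx.
  by congr (_, _); apply: val_inj => /=; move: xy yx; lia.
have -> : n * k = #|e @: setT|.
  by rewrite card_imset // cardsT card_prod !card_ord.
apply: eq_card => E; apply/imsetP/imsetP => [[[[i x] [j y]]]|[[i x] _ ->]].
  rewrite inE /= /copies_adj /= => /andP[/eqP <-] /orP[] /eqP xy ->.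
    have xk : x < k by have := ltn_ord y; rewrite -xy ltnS.
    exists (i, Ordinal xk); rewrite ?inE // /e /=.
    by congr [set (i, _); (i, _)]; apply: val_inj; rewrite //= -xy.
  have yk : y < k by have := ltn_ord x; rewrite -xy ltnS.
  exists (i, Ordinal yk); rewrite ?inE // /e /= setUC.
  by congr [set (i, _); (i, _)]; apply: val_inj; rewrite //= -xy.
exists ((i, widen_ord (leqnSn k) x), (i, lift ord0 x)) => //.
by rewrite inE /= /copies_adj /= eqxx /path_adj /= eqxx.
Qed.

Lemma path_connected m : connected (path_graph m).
Proof.
have up d (x y : path_graph m) : y = x + d :> nat -> connect (@adj (path_graph m)) x y.
  elim: d x => [|d IHd] x yE.
    by have -> : x = y by apply: val_inj; rewrite /= yE addn0.
  have xm : x.+1 < m by have := ltn_ord y; lia.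
  apply: connect_trans (connect1 _) (IHd (Ordinal xm) _); last by rewrite /= yE; lia.
  by rewrite /= /path_adj /= eqxx.
move=> x y; case: (leqP x y) => xy; first by apply: (up (y - x)); lia.
rewrite (sym_connect_sym (@adj_sym _)); apply: (up (x - y)); lia.
Qed.

Lemma copies_path_not_isolated n m (u : copies n (path_graph m)) :
  2 <= m -> exists w, adj u w.
Proof.
case: u => i x m2; case: (ltnP x.+1 m) => xm.
  by exists (i, Ordinal xm); rewrite /= /copies_adj /= /path_adj /= !eqxx.
have xm' : x.-1 < m by have := ltn_ord x; lia.
exists (i, Ordinal xm'); rewrite /= /copies_adj /= /path_adj /= eqxx /=; lia.
Qed.

Lemma copies_path_triangle_free n m : triangle_free (copies n (path_graph m)).
Proof.
move=> [i x] [j y] [k z]; rewrite /= /copies_adj /= /path_adj.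
move=> /andP[_ xy] /andP[_ yz] /andP[_ zx]; lia.
Qed.

(** [lift v.1] skips the copy containing [v]. *)
Lemma copies_delete n (G : sgraph) (v : copies n.+1 G) :
  exists2 f : copies n G -> copies n.+1 G, embedding f & forall u, f u != v.
Proof.
exists (fun u => (lift v.1 u.1, u.2)).
  split=> [[i x] [j y] e|[i x] [j y]].
    by have /lift_inj/= -> := congr1 fst e; have /= -> := congr1 snd e.
  by rewrite /= /copies_adj /= => /andP[/eqP -> ->]; rewrite eqxx.
by move=> u; apply/eqP => /(congr1 fst)/esym/eqP; rewrite /= (negPf (neq_lift _ _)).
Qed.

(** * Cycles *)

Section Cycle.
Variable n : nat.

(** The guard [x != y] excludes a loop when [n] is 1. *)
Definition cycle_adj : rel 'I_n := fun x y =>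
  (x != y) && [|| x.+1 == y, y.+1 == x, (x == 0 :> nat) && (y.+1 == n)
                | (y == 0 :> nat) && (x.+1 == n)].

Lemma cycle_adj_sym : symmetric cycle_adj.
Proof. by move=> x y; rewrite /cycle_adj -!val_eqE; lia. Qed.

Lemma cycle_adj_irrefl : irreflexive cycle_adj.
Proof. by move=> x; rewrite /cycle_adj eqxx. Qed.

Definition cycle_graph : sgraph := SGraph cycle_adj_sym cycle_adj_irrefl.

Lemma cycle_triangle_free : 4 <= n -> triangle_free cycle_graph.
Proof.
move=> n4 x y z; rewrite /= /cycle_adj.
have := ltn_ord x; have := ltn_ord y; have := ltn_ord z; lia.
Qed.

Lemma gsize_cycle : gsize cycle_graph <= n.
Proof.
pose e (x : 'I_n) : {set cycle_graph} := [set x; ordS x].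
rewrite -[leqRHS]card_ord -cardsT; apply: leq_trans (leq_imset_card e _).
apply/subset_leq_card/subsetP => _ /imsetP[[x y] /[!inE] /andP[_ xy] ->].
have succ (a b : 'I_n) : (a.+1 == b) || (b == 0 :> nat) && (a.+1 == n) -> ordS a = b.
  case/orP=> [/eqP ab|/andP[/eqP b0 /eqP an]]; apply: val_inj => /=.
    by rewrite ab modn_small.
  by rewrite an modnn b0.
apply/imsetP; have [/succ yE|/succ xE] :
    ((x.+1 == y) || (y == 0 :> nat) && (x.+1 == n)) \/
    ((y.+1 == x) || (x == 0 :> nat) && (y.+1 == n)) by move: xy => /=; lia.
  by exists x; rewrite /e ?yE.
by exists y; rewrite /e ?xE // setUC.
Qed.

End Cycle.

(** The remaining [n * m] vertices, read in cyclic order from the successor of [v], are cut into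
    consecutive blocks of length [m]. *)
Lemma cycle_delete n m (v : cycle_graph (n * m).+1) :
  exists2 f : copies n (path_graph m) -> cycle_graph (n * m).+1,
    embedding f & forall u, f u != v.
Proof.
(* The existential hides the product, so that linear arithmetic treats [q u] as an atom. *)
have [q qE] : exists q : copies n (path_graph m) -> nat,
  forall u, q u = u.1 * m + u.2 by eexists.
pose pos u := v.+1 + q u.
(* Positions stay below twice the cycle length, so one subtraction reduces them. *)
pose f u : cycle_graph (n * m).+1 :=
  inord (if pos u < (n * m).+1 then pos u else pos u - (n * m).+1).
have vN : v < (n * m).+1 := ltn_ord v.
have lt_nm u : q u < n * m.
  rewrite qE; apply: leq_trans (_ : u.1.+1 * m <= _).
    by rewrite mulSnr ltn_add2l.
  by rewrite leq_mul2r ltn_ord orbT.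
have fE u : f u = (if pos u < (n * m).+1 then pos u else pos u - (n * m).+1) :> nat.
  by rewrite inordK //; have := lt_nm u; rewrite /pos; case: ifP; lia.
exists f; last first.
  by move=> u; rewrite -val_eqE /= fE /pos; have := lt_nm u; case: ifP; lia.
split=> [u w /(congr1 val)|u w].
  rewrite /= !fE /pos => E.
  have {}E : q u = q w.
    by have := lt_nm u; have := lt_nm w; move: E; do 2!case: ifP; lia.
  move: E; rewrite !qE; case: u w => [i x] [j y] /= E.
  have m_gt0 : 0 < m by apply: leq_ltn_trans (ltn_ord x).
  have ij : i = j.
    apply: val_inj; have := congr1 (divn^~ m) E.
    by rewrite /= !divnMDl // !divn_small // !addn0.
  by move: E; rewrite ij => /addnI/val_inj ->.
rewrite /= /copies_adj /= => /andP[/eqP uw xy].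
have {xy} xy : (q u).+1 = q w \/ (q w).+1 = q u.
  by rewrite !qE uw; case/orP: xy => /eqP <-; rewrite addnS; [left|right].
rewrite /cycle_adj -!val_eqE /= !fE /pos; have := lt_nm u; have := lt_nm w.
by do 2!case: ifP; lia.
Qed.

(** * The size Ramsey number *)

(** [3 <= n * m] gives the cycle at least four vertices, hence no triangle; [2 <= m] rules out
    isolated vertices, as the star coloring requires. *)
Lemma size_ramsey_2K2_copies_path n m :
    0 < n -> 2 <= m -> 3 <= n * m ->
  is_size_ramsey (copies 2 (complete_graph 2)) (copies n (path_graph m))
    (minn (n * m + 1) (n.+1 * m.-1)).
Proof.
case: m => [|k] // n_gt0 k_gt0 nm.
set H := copies n _; set r := minn _ _.
have lower (F : sgraph) : arrows F (copies 2 (complete_graph 2)) H -> r <= gsize F.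
  move=> FH; have del v := arrows_2K2_delete v
    (fun u => copies_path_not_isolated u k_gt0) FH.
  (* Whichever copy the all-red coloring yields, it supplies a vertex of [F]. *)
  have [x0] : inhabited F.
    have [[f _ _]|[f _ _]] := FH (fun=> red); split.
      exact: f (ord0, ord0).
    exact: f (Ordinal n_gt0, ord0).
  have [|] := delete_vertex_copies x0 (ord0 : path_graph k.+1) (@path_connected _) n_gt0 del.
    by move/gsize_embedding; rewrite gsize_copies_path geq_min orbC => ->.
  by rewrite /= card_ord geq_min => ->.
split=> //.
(* An upper bound on the size is enough, since [lower] forces equality. *)
suff [F FH Fr] : exists2 F, arrows F (copies 2 (complete_graph 2)) H & gsize F <= r.
  by exists F => //; apply/eqP; rewrite eqn_leq Fr lower.
rewrite /r /minn; case: ifP => _.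
  exists (cycle_graph (n * k.+1).+1); last by rewrite addn1 gsize_cycle.
  apply: arrows_2K2 (cycle_triangle_free _) (@cycle_delete _ _) => //; exact: ord0.
exists (copies n.+1 (path_graph k.+1)); last by rewrite gsize_copies_path.
apply: arrows_2K2 (@copies_path_triangle_free _ _) (@copies_delete _ _).
exact: (ord0, ord0).
Qed.

Theorem proposition3p4 (m : nat) (hm : 3 <= m) :
  is_size_ramsey (copies 2 (complete_graph 2)) (copies 3 (path_graph m))
    (minn (3 * m + 1) (4 * m - 4)) /\
  minn (3 * m + 1) (4 * m - 4) = (if m <= 4 then 4 * m - 4 else 3 * m + 1).
Proof.
(* At [m = 5] both terms equal 16, so the split after 4 agrees with the minimum. *)
split; last by case: ifP; lia.
have -> : 4 * m - 4 = 4 * m.-1 by lia.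
by apply: size_ramsey_2K2_copies_path => //; lia.
Qed.
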